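(* Assume that $2^\kappa<\omega_\omega$ for every cardinal $\kappa<\omega_\omega$. Let $(X,\tau)$ be a linearly Lindelöf space such that $t(X)<\omega_\omega$. Then $X$ is Lindelöf.
   Context: ''Regular'' includes $\mathsf{T}_1$. A space is linearly Lindelöf if it is regular and every open cover of it that is linearly ordered by $\subseteq$ has a countable subcover. A space is Lindelöf if it is regular and every open cover of it has a countable subcover. The tightness $t(X)$ of a space $X$ is the minimum cardinal $\lambda$ such that whenever $x\in\mathrm{cl}(A)$ for some $A\subseteq X$, there exists $B\subseteq A$ with $|B|\leq\lambda$ and $x\in\mathrm{cl}(B)$. Here $\omega_\omega$ is viewed as a cardinal ($\aleph_\omega$). *)

(* Defs.v *)
From mathcomp Require Import all_boot.
From mathcomp Require Import all_classical.
From mathcomp Require Import topology.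

Set Implicit Arguments.
Unset Strict Implicit.
Unset Printing Implicit Defensive.

Local Open Scope classical_set_scope.
Local Open Scope card_scope.

(* A cardinal is represented by an arbitrary type of that cardinality, so that
   "for every cardinal" becomes a quantification over all types. *)

Definition cle (A B : Type) : Prop := [set: A] #<= [set: B].

Definition clt (A B : Type) : Prop := cle A B /\ ~ cle B A.

Definition is_succ_card (A B : Type) : Prop :=
  clt A B /\ forall C : Type, clt A C -> cle B C.

(* [is_aleph n A] says that A has cardinality omega_n. *)
Fixpoint is_aleph (n : nat) (A : Type) : Prop :=
  if n is m.+1 then exists B : Type, is_aleph m B /\ is_succ_card B A
  else [set: A] #= [set: nat].

(* [is_aleph_omega W] says that W has cardinality omega_omega, the supremum of
   the omega_n; such a W exists by [aleph_omega_exists] below. *)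
Definition is_aleph_omega (W : Type) : Prop :=
  (forall n A, is_aleph n A -> cle A W) /\
  (forall C : Type, (forall n A, is_aleph n A -> cle A C) -> cle W C).

(* [regular_space] does not include T1. *)
Definition T3_space (X : topologicalType) : Prop :=
  regular_space X /\ accessible_space X.

Definition is_open_cover (X : topologicalType) (C : set (set X)) : Prop :=
  C `<=` open /\ \bigcup_(U in C) U = setT.

Definition has_countable_subcover (X : topologicalType) (C : set (set X)) :
    Prop :=
  exists D : set (set X),
    [/\ D `<=` C, countable D & \bigcup_(U in D) U = setT].

Definition linearly_lindelof (X : topologicalType) : Prop :=
  T3_space X /\
  forall C : set (set X), is_open_cover C -> total_on C subset ->
    has_countable_subcover C.

Definition lindelof (X : topologicalType) : Prop :=
  T3_space X /\
  forall C : set (set X), is_open_cover C -> has_countable_subcover C.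

Definition tightness_at_most (X : topologicalType) (L : Type) : Prop :=
  forall (A : set X) (x : X), closure A x ->
    exists B : set X, [/\ B `<=` A, B #<= [set: L] & closure B x].

(* [is_tightness X L] says that t(X) is the cardinality of L; such an L exists
   by [tightness_exists] below. *)
Definition is_tightness (X : topologicalType) (L : Type) : Prop :=
  tightness_at_most X L /\
  forall M : Type, tightness_at_most X M -> cle L M.

Lemma cle_inj (A B : Type) : cle A B <-> exists f : A -> B, injective f.
Proof.
split=> [/card_leP[f]|[f finj]].
  exists (fun x => val (f (exist _ x (mem_set I)))) => x y /val_inj.
  by move/(inj (mem_set I) (mem_set I)) => [].
apply: (@card_le_trans _ _ _ (range f)); last exact: card_leT.
have /card_eqPle[] // := inj_card_eq (A := [set: A]) (in2W finj).
Qed.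

Lemma cle_trans (A B C : Type) : cle A B -> cle B C -> cle A C.
Proof. exact: card_le_trans. Qed.

Lemma cle_family_min (I : Type) (A : I -> Type) (i0 : I) :
  exists i, forall j, cle (A i) (A j).
Proof.
pose P (F : set (forall i, A i)) :=
  forall f g, F f -> F g -> forall i, f i = g i -> f = g.
have [|F [PF maxF]] := @Zorn_bigcup _ P.
  move=> C CP Ctot f g [F CF Ff] [G CG Gg].
  by have [FG|GF] := Ctot _ _ CF CG; [apply: (CP G)|apply: (CP F)] => //;
     [exact: FG|exact: GF].
have [[i surj_i]|] := pselect (exists i, forall x : A i, exists2 f, F f & f i = x).
  exists i => j; apply/cle_inj.
  have /choice[h hP] : forall x : A i, exists f, F f /\ f i = x.
    by move=> x; have [f Ff <-] := surj_i x; exists f.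
  exists (fun x => h x j) => x y hxy.
  have [[Fx <-] [Fy <-]] := (hP x, hP y).
  by rewrite (PF _ _ Fx Fy _ hxy).
move=> /forallNP Fnsurj.
have {Fnsurj} miss i : {x : A i | forall f, F f -> f i <> x}.
  apply: cid; have /existsNP[x xP] := Fnsurj i.
  by exists x => f Ff fx; apply: xP; exists f.
pose a i := sval (miss i).
have aP i f : F f -> f i <> a i by exact: (svalP (miss i)).
case: (maxF (F `|` [set a])).
  split=> [|aF]; first exact: subsetUl.
  by apply: (aP i0 a) => //; apply: aF; right.
move=> f g [Ff|->] [Fg|->] i //.
- exact: PF.
- by move=> /(aP _ _ Ff).
- by move=> /esym/(aP _ _ Fg).
Qed.

Lemma cle_total (A B : Type) : cle A B \/ cle B A.
Proof.
have [[] h] := cle_family_min (fun b : bool => if b then A else B) true.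
- by left; exact: (h false).
- by right; exact: (h true).
Qed.

Lemma cle_min (P : Type -> Prop) (T : Type) :
  (forall A B, cle A B -> P A -> P B) -> P T ->
  exists L, P L /\ forall M, P M -> cle L M.
Proof.
move=> Pup PT.
pose J := {S : set T | P {x : T | S x}}.
have PsetT : P {x : T | [set: T] x}.
  apply: Pup PT; apply/cle_inj.
  by exists (fun x => exist _ x I) => x y [].
have sub_cle (S : set T) : cle {x : T | S x} T.
  by apply/cle_inj; exists sval => -[x Sx] [y Sy] /= xy; exact: eq_exist.
have [[S PS] Smin] :=
  cle_family_min (fun j : J => {x : T | sval j x}) (exist _ setT PsetT).
exists {x : T | S x}; split=> // M PM.
have [TM|/cle_inj[f finj]] := cle_total T M.
  exact: cle_trans (sub_cle S) TM.
have Prange : P {x : T | range f x}.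
  apply: Pup PM; apply/cle_inj.
  by exists (fun x => exist _ (f x) (imageT f x)) => x y [] /finj.
apply: cle_trans (Smin (exist _ _ Prange)) _ => /=.
have pre (x : {x : T | range f x}) : {m : M | f m = sval x}.
  by apply: cid; case: (svalP x) => m _ fm; exists m.
apply/cle_inj; exists (fun x => sval (pre x)) => x y xy.
have := svalP (pre x); rewrite xy (svalP (pre y)).
by case: x y {xy} => x Sx [y Sy] /= xy; exact: eq_exist.
Qed.

Lemma clt_cantor (A : Type) : clt A (A -> bool).
Proof.
split.
  apply/cle_inj; exists (fun x y => `[< x = y >]) => x y.
  by move/(congr1 (@^~ y)) => /= /asboolP; rewrite asboolT// => /asboolP.
move=> /cle_inj[f finj].
pose D x := `[< exists2 g, f g = x & ~~ g x >].
have : D (f D) = ~~ D (f D).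
  apply/idP/idP => [/asboolP[g /finj -> //]|nD].
  by apply/asboolP; exists D.
by case: (D _).
Qed.

Lemma is_succ_card_exists (A : Type) : exists B, is_succ_card A B.
Proof.
apply: (@cle_min (clt A) (A -> bool)); last exact: clt_cantor.
move=> B C BC [AB nBA]; split; first exact: cle_trans BC.
by move=> CA; apply: nBA; exact: cle_trans CA.
Qed.

Lemma is_aleph_exists (n : nat) : exists A, is_aleph n A.
Proof.
elim: n => [|n [A An]]; first by exists nat; exact: card_eqxx.
by have [B AB] := is_succ_card_exists A; exists B, A.
Qed.

Lemma is_aleph_cle (n : nat) (A B : Type) :
  is_aleph n A -> is_aleph n B -> cle A B.
Proof.
elim: n A B => [|n IHn] A B /=.
  move=> /card_eqPle[An _] /card_eqPle[_ nB]; exact: card_le_trans nB.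
move=> [A' [nA' [A'A Amin]]] [B' [nB' [[B'B nBB'] Bmin]]].
apply: Amin; split; first exact: cle_trans (IHn _ _ nA' nB') B'B.
by move=> BA'; apply: nBB'; exact: cle_trans BA' (IHn _ _ nA' nB').
Qed.

Lemma aleph_omega_exists : exists W, is_aleph_omega W.
Proof.
pose A n : Type := sval (cid (is_aleph_exists n)).
have AP n : is_aleph n (A n) by exact: (svalP (cid (is_aleph_exists n))).
apply: (@cle_min (fun W => forall n B, is_aleph n B -> cle B W) {n & A n}).
  by move=> B C BC Bub n D /Bub DB; exact: cle_trans BC.
move=> n B nB; apply: cle_trans (is_aleph_cle nB (AP n)) _.
apply/cle_inj; exists (fun x => Tagged A x) => x y.
by move/(congr1 (tagged_as (Tagged A x))); rewrite !(tagged_asE (u := Tagged A x)).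
Qed.

Lemma tightness_exists (X : topologicalType) : exists L, is_tightness X L.
Proof.
apply: (@cle_min (tightness_at_most X) X).
  move=> L M LM LX A x /LX[B [BA BL Bx]]; exists B; split=> //.
  exact: card_le_trans LM.
by move=> A x Ax; exists A; split=> //; exact: card_leT.
Qed.

(* Main.v *)
Require Import Defs.
From mathcomp Require Import all_boot.
From mathcomp Require Import all_classical.
From mathcomp Require Import topology.
From mathcomp Require Import wochoice.

(** Linear Lindelofness already reduces every open cover with fewer than
    omega_omega members to a countable one ([small_cover]).  By induction on n,
    a cover (U_k) indexed by omega_{n+1} is replaced by the increasing cover
    W_k, the union of the U_j with j <= k.  The chain has a countable
    subcover, and since omega_{n+1} is regular and uncountable a countable set
    of indices is bounded; so a single W_k is everything
    ([increasing_cover]), which is a cover by at most omega_n sets.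

    Regularity of the space and the strong limit hypothesis then take care of closures of
    small sets ([closure_cover]).  Let A have fewer than omega_omega points and
    let open sets U_j cover cl(A).  A point x of cl(A) lies in some U_j, hence
    has a neighbourhood N with cl(N) inside U_j, and x is in the closure of the
    trace B of N on A.  Thus the sets U_j chosen for those B included in A
    whose closure fits into a member of the cover suffice; there are at most
    2^|A| < omega_omega of them, so countably many suffice as well.

    Finally let omega_n bound the tightness, and suppose that an open cover has
    no countable subcover ([tightness_cover]).  By recursion along omega_{n+1}
    choose points x_k and countable unions O_k of members of the cover, so
    that x_k is outside O_j for all j < k while O_k contains the closure of
    {x_j : j <= k}.  The point exists because otherwise the O_j with j < k would
    be a cover by at most omega_n sets, and the set O_k exists by the preceding
    paragraph.  Let F be the closure of {x_k : k in omega_{n+1}}.  By tightness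
    each point of F is in the closure of at most omega_n of the points x_k;
    their indices are bounded, so the O_k cover F.  The increasing open
    sets made of the O_j with j <= k and the complement of F thus cover X, and
    one of them must be X by [increasing_cover]; yet it misses x_j for
    every j > k.

    The cardinal arithmetic behind this is the regularity of omega_{n+1}
    ([short_well_order_bounded]), which rests on the idempotence of omega_n
    under products ([is_aleph_infinite_square]). *)

Set Implicit Arguments.
Unset Strict Implicit.
Unset Printing Implicit Defensive.

Local Open Scope classical_set_scope.
Local Open Scope card_scope.

(** * Cardinal comparison and recursion *)

Lemma cle_surj (A B : Type) (a0 : A) :
  cle A B -> exists g : B -> A, forall a, exists b, g b = a.
Proof.
move=> /cle_inj[f finj].
have /choice[g gP] : forall b, exists a, (exists a', f a' = b) -> f a = b.
  move=> b; have [[a fa]|nb] := pselect (exists a', f a' = b).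
    by exists a.
  by exists a0 => /nb.
by exists g => a; exists (f a); apply: finj; apply: gP; exists a.
Qed.

Lemma cle_set (T L : Type) (A : set T) :
  A #<= [set: L] -> cle {x | A x} L.
Proof.
move=> /card_leP[f]; apply/cle_inj.
exists (fun x : {x | A x} => val (f (exist _ (sval x) (mem_set (svalP x))))).
move=> [x Ax] [y Ay] /= /val_inj.
by move/(inj (mem_set I) (mem_set I)) => [xy]; exact: eq_exist.
Qed.

Lemma cle_choice (I L : Type) (A : I -> Type) :
  (forall i, cle (A i) L) ->
  exists e : forall i, A i -> L, forall i, injective (e i).
Proof.
move=> AL; have e i : {e : A i -> L | injective e} by exact/cid/cle_inj.
by exists (fun i => sval (e i)) => i; exact: svalP (e i).
Qed.

(** Dependent choice along a well-founded relation.  The condition [Q k f t] on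
    the value [t] at [k] may refer to the earlier values of [f]; passing a
    total [f], together with the requirement that [Q] reads it only below [k],
    avoids partial functions in the applications. *)
Lemma wf_choice (K T : Type) (t0 : T) (lt : K -> K -> Prop)
    (Q : K -> (K -> T) -> T -> Prop) :
  well_founded lt ->
  (forall k f g t, (forall j, lt j k -> f j = g j) -> Q k f t -> Q k g t) ->
  (forall k f, exists t, Q k f t) ->
  exists f, forall k, Q k f (f k).
Proof.
move=> wf Qext Qex.
have /choice[pick pickP] :
    forall kf : K * (K -> T), exists t, Q kf.1 kf.2 t.
  by move=> [k f]; exact: Qex.
pose extend k (h : forall j, lt j k -> T) j :=
  if pselect (lt j k) is left p then h j p else t0.
pose step k h := pick (k, extend k h).
have stepE k h h' : (forall j p, h j p = h' j p) -> step k h = step k h'.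
  move=> hh'; congr (pick (k, _)); apply/funext => j.
  by rewrite /extend; case: pselect.
pose f := Fix wf (fun _ => T) step.
exists f => k; apply: (Qext k (extend k (fun j _ => f j))).
  by move=> j jk; rewrite /extend; case: pselect.
by rewrite [f k]Fix_eq //; exact: (pickP (k, _)).
Qed.

(** * Short well-orders and regularity of successors *)

(** An order [le] on [K] in the manner of the ordinal [L]^+: a well-order whose
    initial segments have size at most [L].  The strict order is written
    [~ le j i], and closed initial segments are the ones bounded in size, so
    that they contain their endpoint in the unions taken later. *)
Record short_well_order (L K : Type) (le : K -> K -> Prop) : Prop := {
  swo_trans : forall i j k, le i j -> le j k -> le i k;
  swo_anti : forall i j, le i j -> le j i -> i = j;
  swo_total : forall i j, le i j \/ le j i;
  swo_wf : well_founded (fun i j => ~ le j i);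
  swo_short : forall k, cle {j | le j k} L }.

(** Antisymmetry and least elements determine a well-order; totality,
    transitivity and well-foundedness are recovered from them where needed. *)
Lemma well_order_le (K : Type) : exists le : K -> K -> Prop,
  (forall i j, le i j -> le j i -> i = j) /\
  forall P : K -> Prop, (exists k, P k) ->
    exists k, P k /\ forall j, P j -> le k j.
Proof.
have [R Rwo] := well_ordering_principle {classic K}.
have least (P : K -> Prop) (k : K) : P k ->
    exists2 m : K, (P m /\ forall j, P j -> R m j) &
      forall m', P m' -> (forall j, P j -> R m' j) -> m = m'.
  move=> Pk.
  have [|m [[mP mlb] muniq]] := Rwo [pred x : {classic K} | `[< P x >]].
    by exists k; exact/asboolP.
  exists m; first by split=> [|j Pj]; [exact/asboolP|apply/mlb/asboolP].
  move=> m' Pm' m'lb; apply: muniq; split; first exact/asboolP.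
  by move=> j /asboolP; exact: m'lb.
exists R; split=> [i j ij ji|P [k Pk]]; last first.
  by have [m mP _] := least P k Pk; exists m.
have refl x : R x x.
  by have [m [-> mlb] _] := least (eq x) x erefl; exact: mlb.
have [|m _ muniq] := least (fun x => x = i \/ x = j) i; first by left.
have <- : m = i by apply: muniq => [|x [->|->]]; [left|exact: refl|].
by apply: muniq => [|x [->|->]]; [right| |exact: refl].
Qed.

(** Take any well-order of [K].  If some initial segment is not of size at most
    [L], then the least such segment has size at least [K] by minimality of the
    successor, while the shorter segments are small; so the order is pulled
    back along an injection of [K] into that segment.  The hypothesis on
    [option L] accounts for the endpoint of a closed segment. *)
Lemma short_well_order_exists (L K : Type) :
  cle (option L) L -> is_succ_card L K -> exists le, @short_well_order L K le.
Proof.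
move=> LoptL [[LK nKL] Kmin].
have [R [Ranti Rleast]] := well_order_le K.
have Rtot i j : R i j \/ R j i.
  have [|m [[->|->] mlb]] := Rleast (fun x => x = i \/ x = j).
  - by exists i; left.
  - by left; apply: mlb; right.
  - by right; apply: mlb; left.
have Rtrans i j k : R i j -> R j k -> R i k.
  move=> ij jk; have [|m [mP mlb]] := Rleast (fun x => [\/ x = i, x = j | x = k]).
    by exists i; constructor 1.
  have [Rmi Rmj Rmk] : [/\ R m i, R m j & R m k].
    by split; apply: mlb; [constructor 1|constructor 2|constructor 3].
  case: mP => mE; move: Rmi Rmj Rmk; rewrite mE //.
  - by move=> /(Ranti _ _ ij) ->.
  - by move=> _ /(Ranti _ _ jk) <-.
have Rwf : well_founded (fun i j => ~ R j i).
  move=> k; apply: contrapT => nk.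
  have [|m [nm mlb]] := Rleast (fun k => ~ Acc (fun i j => ~ R j i) k).
    by exists k.
  by apply: nm; constructor => j mj; apply: contrapT => /mlb.
have [f [finj fshort]] : exists f : K -> K,
    injective f /\ forall k, cle {j | ~ R (f k) j} L.
  have [short|/existsNP long] := pselect (forall k, cle {j | ~ R k j} L).
    by exists id; split=> // i j.
  (* Strict segments are used here, so that those below elements of the least
     long segment are shorter than it. *)
  have [a [longa amin]] := Rleast (fun k => ~ cle {j | ~ R k j} L) long.
  have /cle_inj[f finj] : cle K {j | ~ R a j}.
    by apply: Kmin; split=> //; have [] := cle_total L {j | ~ R a j}.
  exists (sval \o f); split.
    by apply: inj_comp finj => -[x Px] [y Py] /= xy; exact: eq_exist.
  by move=> k; apply: contrapT => /amin; exact: (svalP (f k)).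
exists (fun i j => R (f i) (f j)); split.
- by move=> i j k; exact: Rtrans.
- by move=> i j ij ji; apply/finj/Ranti.
- by move=> i j; exact: Rtot.
- move=> k; move: {2}(f k) (erefl (f k)) => x; elim: {x}(Rwf x) k => x _ IHx k fk.
  by constructor => j; rewrite fk => jx; exact: (IHx (f j)).
move=> k; apply: cle_trans LoptL; apply: cle_trans (_ : cle (option {j | ~ R (f k) j}) _).
  apply/cle_inj; exists (fun j : {j | R (f j) (f k)} =>
    if pselect (~ R (f k) (f (sval j))) is left p
    then Some (exist (fun j => ~ R (f k) j) _ p) else None).
  move=> [i ik] [j jk] /=; case: pselect => [p|/contrapT ki]; case: pselect => [q|/contrapT kj] //.
    by move=> [/finj ij]; exact: eq_exist.
  by move=> _; apply/eq_exist/finj; rewrite (Ranti _ _ ik ki) (Ranti _ _ jk kj).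
have /cle_inj[g ginj] := fshort k.
by apply/cle_inj; exists (omap g) => -[x|] [y|] //= [/ginj->].
Qed.

(** The idempotence [L * L = L] of infinite cardinals. *)
Definition square (L : Type) : Prop := cle (L * L) L.

Lemma square_option (L : Type) : cle nat L -> square L -> cle (option L) L.
Proof.
move=> /cle_inj[e einj] /cle_inj[p pinj]; apply/cle_inj.
exists (fun o => if o is Some x then p (e 1, x) else p (e 0, e 0)).
by move=> [x|] [y|] // /pinj[] => [->|/einj|/einj].
Qed.

(** Regularity of the successor cardinal: if the values of [f] were unbounded,
    [K] would be a union of at most [L] initial segments, hence of size at most
    [L * L = L]. *)
Lemma short_well_order_bounded (L K J : Type) (le : K -> K -> Prop)
    (f : J -> K) :
  square L -> ~ cle K L -> short_well_order L le -> cle J L ->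
  exists k, forall j, le (f j) k.
Proof.
move=> LL nKL leP /cle_inj[h hinj]; apply: contrapT => /forallNP unb.
apply: nKL; apply: cle_trans LL.
have /choice[s sP] : forall k, exists j, le k (f j).
  move=> k; have /existsNP[j kj] := unb k; exists j.
  by have [] := swo_total leP k (f j).
have [e einj] := cle_choice (swo_short leP).
apply/cle_inj; exists (fun k => (h (s k), e (f (s k)) (exist _ k (sP k)))).
move=> i j [/hinj ij].
move: (sP i) (sP j); rewrite -ij => Pi Pj /einj [] //.
Qed.

(** A pair in [K * K] is determined by which component is the larger one, by
    that component, and by the position in [L] of the other one in its initial
    segment.  So [K * K] embeds into [K * L], and it remains to embed [K * L]
    into [K]: by recursion along [K], disjoint copies of [L] are placed in [K],
    and there is always room because fewer than [K] points have been used. *)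
Lemma square_succ (L K : Type) : cle nat L -> square L -> is_succ_card L K ->
  square K.
Proof.
move=> natL LL LK; have [[leLK nKL] _] := LK.
have [le leP] := short_well_order_exists (square_option natL LL) LK.
have [e einj] := cle_choice (swo_short leP).
have [p pinj] : exists p : L * L -> L, injective p by exact/cle_inj.
have [c cinj] : exists c : nat -> L, injective c by exact/cle_inj.
pose l0 := c 0.
have c01 : c 0 <> c 1 by move/cinj.
have [g [ginj gdisj]] : exists g : K -> L -> K, (forall k, injective (g k)) /\
    forall j k l l', g j l = g k l' -> j = k.
  have [k0 _] : {k : K | True}.
    by apply: cid; have /cle_inj[f _] := leLK; exists (f l0).
  have [|||g gP] := @wf_choice K (L -> K) (fun=> k0) (fun j k => ~ le k j)
    (fun k f g => injective g /\ forall j, ~ le k j -> forall l l', f j l <> g l').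
  - exact: (swo_wf leP).
  - move=> k f f' g ff' [ginj gf]; split=> // j kj l l'.
    by rewrite -ff' //; exact: gf.
  - move=> k f; pose S x := exists j, ~ le k j /\ exists l, f j l = x.
    (* Either the unused points contain a copy of [L], or both the used and
       the unused points number at most [L], and then so do all of [K]. *)
    have [/cle_inj[g ginj]|/cle_inj[h hinj]] := cle_total L {x | ~ S x}.
      exists (sval \o g); split.
        by apply: inj_comp ginj => -[x Px] [y Py] /= xy; exact: eq_exist.
      move=> j kj l l' fl; apply: (svalP (g l')); exists j; split=> //.
      by exists l.
    case: nKL.
    pose code x t := (exists j (jk : le j k) l,
        f j l = x /\ t = p (c 0, p (e k (exist _ j jk), l))) \/
      exists nSx : ~ S x, t = p (c 1, h (exist _ x nSx)).
    have /choice[t tP] : forall x, exists t, code x t.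
      move=> x; have [[j [kj [l fl]]]|nSx] := pselect (S x).
        have jk : le j k by have [] := swo_total leP j k.
        by eexists; left; exists j, jk, l.
      by eexists; right; exists nSx.
    apply/cle_inj; exists t => x y txy.
    move: (tP x) (tP y); rewrite -txy.
    move=> [[j [jk [l [<- ->]]]]|[nSx ->]] [[j' [jk' [l' [<-]]]]|[nSy]] /pinj[] //.
    by move=> /pinj[/einj[->] ->].
    by move=> /esym/c01.
    by move=> /hinj[].
  exists g; split=> [k|j k l l']; first by have [] := gP k.
  move=> gjk; apply: (swo_anti leP); apply: contrapT.
    by have [_ gj] := gP j => /gj/(_ l' l); exact.
  by have [_ gk] := gP k => /gk/(_ l l'); exact.
have gdisjp j k l l' : g j l = g k l' -> (j, l) = (k, l').
  by move=> E; have jk := gdisj _ _ _ _ E; move: E; rewrite jk => /ginj->.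
(* The tags [c 0] and [c 1] record which component is the larger one. *)
pose code (q : K * K) x :=
  (exists q12 : le q.1 q.2, x = g q.2 (p (c 0, e q.2 (exist _ q.1 q12)))) \/
  (exists q21 : le q.2 q.1, x = g q.1 (p (c 1, e q.1 (exist _ q.2 q21)))).
have /choice[t tP] : forall q, exists x, code q x.
  move=> q; have [h|h] := swo_total leP q.1 q.2.
    by eexists; left; exists h.
  by eexists; right; exists h.
apply/cle_inj; exists t => -[i j] [i' j'] tij.
move: (tP (i, j)) (tP (i', j')); rewrite -tij.
move=> [] [h ->] [] [h' /gdisjp[]] /=.
- by move: h h' => /= + + jj'; rewrite -jj' => h h' /pinj[/einj[->]].
- by move=> _ /pinj[].
- by move=> _ /pinj[/esym].
- by move: h h' => /= + + ii'; rewrite -ii' => h h' /pinj[/einj[->]].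
Qed.

Lemma is_aleph_infinite_square (n : nat) (K : Type) :
  is_aleph n K -> cle nat K /\ square K.
Proof.
elim: n K => [|n IHn] K /=.
  move=> /card_eqPle[Kn nK]; split=> //; rewrite /square.
  apply: cle_trans nK; apply: (@cle_trans _ (nat * nat)).
    have /cle_inj[f finj] : cle K nat by [].
    by apply/cle_inj; exists (fun q => (f q.1, f q.2)) => -[x y] [x' y'] [/finj/= -> /finj/= ->].
  by apply/cle_inj; exists pickle; exact: (pcan_inj pickleK).
move=> [L [/IHn[natL LL] LK]]; split; last exact: square_succ LK.
by have [[leLK _] _] := LK; exact: cle_trans leLK.
Qed.

(** * Covers of linearly Lindelof spaces *)

Lemma lt_aleph_omega (W J : Type) : is_aleph_omega W -> clt J W ->
  exists n K, is_aleph n K /\ cle J K.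
Proof.
move=> [_ Wlub] [_ nWJ]; apply: contrapT => no; apply: nWJ; apply: Wlub.
move=> n K nK; have [//|JK] := cle_total K J.
by case: no; exists n, K.
Qed.

Lemma aleph_lt_omega (W J : Type) n K :
  is_aleph_omega W -> is_aleph n K -> cle J K -> clt J W.
Proof.
move=> [Wub _] nK JK; have [K' KK'] := is_succ_card_exists K.
have K'W : cle K' W by apply: (Wub n.+1) => /=; exists K.
have [[leKK' nKK'] _] := KK'.
split; first exact: cle_trans (cle_trans JK leKK') K'W.
by move=> WJ; apply: nKK'; apply: cle_trans K'W (cle_trans WJ JK).
Qed.

(** Countable subcovers of an indexed cover are given as sequences of indices:
    repetitions are harmless, and a countable union of countable subcovers is
    again a sequence through the pairing of natural numbers. *)
Definition covers_by_sequence (X J : Type) (F : set X) (U : J -> set X) :=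
  exists s : nat -> J, F `<=` \bigcup_n U (s n).

Section LinearlyLindelof.
Variables (X : topologicalType) (linX : linearly_lindelof X) (x0 : X).

(** A chain of open sets of length a regular uncountable cardinal cannot cover
    the space unless it reaches it: the indices of a countable subcover are
    bounded. *)
Lemma increasing_cover (L K : Type) (le : K -> K -> Prop) (W : K -> set X) :
  cle nat L -> square L -> ~ cle K L -> short_well_order L le ->
  (forall k, open (W k)) -> (forall j k, le j k -> W j `<=` W k) ->
  (forall x, exists k, W k x) -> exists k, W k = setT.
Proof.
move=> natL LL nKL leP Wo Wmono Wcov.
have [||D [DW /cle_set Dcount Dcov]] := linX.2 (range W).
- split; first by move=> _ [k _ <-].
  by apply/seteqP; split=> // x _; have [k Wkx] := Wcov x; exists (W k) => //; exists k.
- move=> _ _ [j _ <-] [k _ <-].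
  by have [/Wmono|/Wmono] := swo_total leP j k; [left|right].
have /choice[d dP] : forall V : {V | D V}, exists k, W k = sval V.
  by move=> V; have [k _ Wk] := DW _ (svalP V); exists k.
have [k kP] := short_well_order_bounded d LL nKL leP (cle_trans Dcount natL).
exists k; apply/seteqP; split=> // x _.
have : [set: X] x by []. rewrite -Dcov => -[V DV Vx].
by apply: (Wmono _ _ (kP (exist _ V DV))); rewrite dP.
Qed.

(** Induction on [n]: the partial unions along a short well-order form an
    increasing cover, so one of them is the whole space, and it is a union of
    fewer members of the cover. *)
Lemma small_cover (n : nat) (K J : Type) (U : J -> set X) :
  is_aleph n K -> cle J K -> (forall i, open (U i)) ->
  (forall x, exists i, U i x) -> covers_by_sequence setT U.
Proof.
elim: n K J U => [|n IHn] K J U nK JK Uo Ucov; have [i0 _] := Ucov x0.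
  have [|s sP] := cle_surj i0 (_ : cle J nat).
    by apply: (cle_trans JK); move: nK => /= /card_eqPle[].
  by exists s => x _; have [i Uix] := Ucov x; have [m sm] := sP i; exists m => //; rewrite sm.
move: nK => /= [L [nL LK]].
have [natL LL] := is_aleph_infinite_square nL.
have [le leP] := short_well_order_exists (square_option natL LL) LK.
have [g gP] := cle_surj i0 JK.
have [|k|j k jk x [i ij Uix]|x|k Wk] := increasing_cover
  (W := fun k => \bigcup_(j in le^~ k) U (g j)) natL LL _ leP.
- by have [[]] := LK.
- exact: bigcup_open.
- by exists i => //; exact: (swo_trans leP) ij jk.
- have [i Uix] := Ucov x; have [k gk] := gP i; exists k, k; last by rewrite gk.
  by have [] := swo_total leP k k.
have [|x|s sP] := IHn L {j | le j k} (fun j => U (g (sval j))) nL (swo_short leP k).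
- by move=> j; exact: Uo.
- have : [set: X] x by []. rewrite -Wk => -[j jk Ux].
  by exists (exist _ j jk).
by exists (fun m => g (sval (s m))).
Qed.

Lemma small_cover_closed (n : nat) (K J : Type) (i0 : J) (F : set X) (U : J -> set X) :
  is_aleph n K -> cle J K -> closed F -> (forall i, open (U i)) ->
  (forall x, F x -> exists i, U i x) -> covers_by_sequence F U.
Proof.
move=> nK JK Fc Uo Ucov.
have [i|x|s sP] := small_cover (U := fun i => U i `|` ~` F) nK JK.
- by apply: openU => //; exact: closed_openC.
- have [/Ucov[i Uix]|nFx] := pselect (F x); first by exists i; left.
  by exists i0; right.
by exists s => x Fx; have [m _ [|]] := sP x I; [exists m|].
Qed.

(** The cover of [closure (range a)] is refined to one indexed by the subsets of
    [P]: a subset [S] is sent to a member of the cover that contains the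
    closure of its image, if there is one.  Regularity makes this a cover, and
    the power set of [P] is small enough for [small_cover_closed]. *)
Lemma closure_cover (W P J : Type) (j0 : J) (a : P -> X) (U : J -> set X) :
  is_aleph_omega W -> clt (P -> bool) W -> (forall j, open (U j)) ->
  (forall x, closure (range a) x -> exists j, U j x) ->
  covers_by_sequence (closure (range a)) U.
Proof.
move=> hW /(lt_aleph_omega hW)[n [K [nK PK]]] Uo Ucov.
pose B (S : P -> bool) := closure (a @` S).
have /choice[phi phiP] : forall S, exists j,
    (exists j', B S `<=` U j') -> B S `<=` U j.
  move=> S; have [[j Bj]|nB] := pselect (exists j', B S `<=` U j').
    by exists j.
  by exists j0 => /nB.
have [||x|s sP] := small_cover_closed (F := closure (range a)) (U := U \o phi)
  (fun=> false) nK PK.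
- exact: closed_closure.
- by move=> S; exact: Uo.
- move=> ax; have [j Ujx] := Ucov x ax.
  have [N Nx NU] := linX.1.1 x (U j) (open_nbhs_nbhs (conj (Uo j) Ujx)).
  pose S p := `[< N (a p) >].
  exists S => /=; apply: phiP.
    exists j; apply: subset_trans NU; apply: closureS.
    by move=> _ [p /asboolP Np <-].
  move=> M /(filterI Nx)/ax[_ [[p _ <-] [Np Mp]]].
  by exists (a p); split=> //; exists p => //; exact/asboolP.
by exists (phi \o s).
Qed.

(** The recursion of length [L]^+ described at the top.  A stage [f k] is the
    pair of the point x_k and of the sequence of indices whose members of the
    cover form O_k.  Tightness at most [L] makes the closure of all the points
    the increasing union of the closures of the initial segments, because a set
    of at most [L] indices is bounded. *)
Lemma tightness_cover (W L J : Type) n (U : J -> set X) :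
  is_aleph_omega W ->
  (forall K : Type, clt K W -> clt (K -> bool) W) ->
  is_aleph n L -> tightness_at_most X L -> (forall j, open (U j)) ->
  (forall x, exists j, U j x) -> covers_by_sequence setT U.
Proof.
move=> hW hpow nL tL Uo Ucov; apply: contrapT => nU.
have [j0 _] := Ucov x0.
have [K LK] := is_succ_card_exists L.
have [natL LL] := is_aleph_infinite_square nL.
have [le leP] := short_well_order_exists (square_option natL LL) LK.
have nKL : ~ cle K L by have [[]] := LK.
pose O (V : nat -> J) := \bigcup_m U (V m).
have Oo V : open (O V) by apply: bigcup_open.
have nO (P : Type) (V : P -> nat -> J) : cle P L -> exists x, forall p, ~ O (V p) x.
  move=> PL; apply: contrapT => /forallNP OT; apply: nU.
  have [p|x|s sP] := small_cover (U := O \o V) nL PL.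
  - exact: Oo.
  - by have /existsNP[p /contrapT] := OT x; exists p.
  (* A countable union of the sets [O (V p)] is again of the form [O V']. *)
  exists (fun m => if unpickle m is Some (i, l) then V (s i) l else j0).
  move=> x /sP[i _ [l _ Ux]].
  by exists (pickle (i, l)) => //; rewrite pickleK.
have [|||f fP] := @wf_choice K (X * (nat -> J)) (x0, fun=> j0) (fun j k => ~ le k j)
    (fun k f t => (forall j, ~ le k j -> ~ O (f j).2 t.1) /\
      closure ([set (f j).1 | j in fun j => ~ le k j] `|` [set t.1]) `<=` O t.2).
- exact: (swo_wf leP).
- move=> k f g t fg [tO tcl]; split=> [j kj|]; first by rewrite -fg //; exact: tO.
  apply: subset_trans tcl; apply: closureS => _ [[j kj <-]|->]; last by right.
  by left; exists j => //; rewrite fg.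
- move=> k f.
  have Psmall : cle {j | ~ le k j} L.
    apply: cle_trans (swo_short leP k); apply/cle_inj.
    have h j : ~ le k j -> le j k by move=> kj; have [] := swo_total leP j k.
    exists (fun j => exist (fun j => le j k) (sval j) (h _ (svalP j))).
    by move=> [i ik] [j jk] [ij]; exact: eq_exist.
  have [x xO] := nO _ (fun j : {j | ~ le k j} => (f (sval j)).2) Psmall.
  (* [None] stands for the new point, so that [a] enumerates all the points
     chosen up to stage [k]. *)
  pose a (o : option {j | ~ le k j}) := if o is Some j then (f (sval j)).1 else x.
  have aE : [set (f j).1 | j in fun j => ~ le k j] `|` [set x] = range a.
    apply/seteqP; split=> [_ [[j kj <-]|->]|_ [[j|] _ <-] /=].
    + by exists (Some (exist _ j kj)).
    + by exists None.
    + by left; exists (sval j) => //; exact: (svalP j).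
    + by right.
  have [||V VP] := @closure_cover W _ _ j0 a U hW _ Uo.
  - apply: hpow; apply: (aleph_lt_omega hW nL).
    apply: cle_trans (square_option natL LL); have /cle_inj[g ginj] := Psmall.
    by apply/cle_inj; exists (omap g) => -[y|] [z|] //= [/ginj->].
  - by move=> y _; exact: Ucov.
  exists (x, V); split=> [j kj|]; first exact: (xO (exist _ j kj)).
  by rewrite /= aE.
have [k0 _] : exists k : K, True.
  have [[/(cle_trans natL)/cle_inj[h _] _] _] := LK.
  by exists (h 0).
pose F := closure (range (fun k => (f k).1)).
have [|k|j k jk x|x|k Wk] := increasing_cover
  (W := fun k => (\bigcup_(j in le^~ k) O (f j).2) `|` ~` F) natL LL _ leP.
- exact: nKL.
- by apply: openU; [apply: bigcup_open|exact/closed_openC/closed_closure].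
- move=> [[i ij Ox]|]; last by right.
  by left; exists i => //; exact: (swo_trans leP) ij jk.
- have [Fx|nFx] := pselect (F x); last by exists k0; right.
  have [B [BF BL Bx]] := tL _ _ Fx.
  have /choice[d dP] : forall b : {b | B b}, exists k, (f k).1 = sval b.
    by move=> b; have [k _ fk] := BF _ (svalP b); exists k.
  have [k kP] := short_well_order_bounded d LL nKL leP (cle_set BL).
  exists k; left; exists k; first by have [] := swo_total leP k k.
  have [_ clO] := fP k; apply: clO; apply: closureS Bx => b Bb.
  have [j jk <-] : exists2 j, le j k & (f j).1 = b.
    by exists (d (exist _ b Bb)); [exact: kP|rewrite dP].
  have [kj|] := pselect (le k j); last by left; exists j.
  by right; rewrite (swo_anti leP jk kj).
(* The order has no greatest element, as its closed segments are smaller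
   than [K]; a later point [(f j).1] is in [F] but escapes the earlier sets. *)
have [j jk] : exists j, ~ le j k.
  apply: contrapT => /forallNP all; apply: nKL; apply: cle_trans (swo_short leP k).
  apply/cle_inj; exists (fun j => exist (fun j => le j k) j (contrapT (all j))).
  by move=> i j [].
have : [set: X] (f j).1 by []. rewrite -Wk => -[[i ik Of]|]; last first.
  by apply; apply: subset_closure; exists j.
have [fO _] := fP j; apply: (fO i) Of => ji.
by apply: jk; exact: (swo_trans leP) ji ik.
Qed.

End LinearlyLindelof.

Theorem theorem5p4 (omega_omega : Type)
    (homega : is_aleph_omega omega_omega)
    (hpow : forall K : Type, clt K omega_omega -> clt (K -> bool) omega_omega)
    (X : topologicalType) (hX : linearly_lindelof X)
    (tX : Type) (htX : is_tightness X tX) (htX_lt : clt tX omega_omega) :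
  lindelof X.
Proof.
split=> [|C [Co Ccov]]; first exact: hX.1.
have [[x0 _]|noX] := pselect (exists x : X, True); last first.
  exists set0; split=> //.
  by apply/seteqP; split=> // x; case: noX; exists x.
have [n [L [nL tL]]] := lt_aleph_omega homega htX_lt.
have tXL : tightness_at_most X L.
  move=> A x /(htX.1 A)[B [BA BL Bx]]; exists B; split=> //.
  exact: card_le_trans tL.
have [U|x|s sP] := @tightness_cover X hX x0 omega_omega L {U | C U} n sval
  homega hpow nL tXL.
- exact/Co/(svalP U).
- have : [set: X] x by []. rewrite -Ccov => -[U CU Ux].
  by exists (exist _ U CU).
exists (range (fun m => sval (s m))); split.
- by move=> _ [m _ <-]; exact: (svalP (s m)).
- exact: card_image_le.
- apply/seteqP; split=> // x /sP[m _ sx].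
  by exists (sval (s m)).
Qed.
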